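(* Let $A$ be an abelian variety of dimension $g\geq2$ over the finite field $\mathbb{F}_q$, let $N_n=N_n(A)$ and $N=N_1$, and let $\eta=\eta(A)$ be the harmonic mean of the numbers $q+1+x_i$ ($1\le i\le g$). Assume that $N_n\geq N_1\geq0$ for $1\leq n\leq2g$. Then $$|A(\mathbb{F}_q)|\geq\frac\eta g\left[\binom{N+g-2}{g-2}+\sum_{n=0}^{g-1}q^{g-1-n}\binom{N+n-1}{n}\right].$$
   Context: Let $A$ be an abelian variety of dimension $g$ over $\mathbb{F}_q$, with Weil polynomial $f_A(t)$ (characteristic polynomial of its Frobenius endomorphism), whose complex roots are $\omega_1,\dots,\omega_g,\overline\omega_1,\dots,\overline\omega_g$, with $|\omega_i|=q^{1/2}$. Put $x_i=-(\omega_i+\overline\omega_i)$; then $|A(\mathbb{F}_q)|=f_A(1)=\prod_{i=1}^g(q+1+x_i)$. The harmonic mean $\eta=\eta(A)$ is defined by $\dfrac1\eta=\dfrac1g\sum_{i=1}^g\dfrac1{q+1+x_i}$. Put $P_A(t)=t^{2g}f_A(t^{-1})$ and $Z_A(t)=\dfrac{P_A(t)}{(1-t)(1-qt)}$. The numbers $N_n=N_n(A)$ are defined by $\log Z_A(t)=\sum_{n\ge1}N_n\frac{t^n}{n}$, equivalently $N_n=q^n+1-\sum_{i=1}^g(\omega_i^n+\overline\omega_i^n)$ (this is not $|A(\mathbb{F}_{q^n})|$). Binomial coefficients are generalized ones: $\binom r0=1$ and $\binom rk=\frac{r(r-1)\cdots(r-k+1)}{k!}$ for $r\in\mathbb{C}$,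 $k\in\mathbb{N}$. *)

(* Defs.v *)
From HB Require Import structures.
From mathcomp Require Import all_boot all_order all_algebra all_field.
From mathcomp Require Import mpoly.
Set Implicit Arguments.
Unset Strict Implicit.
Unset Printing Implicit Defensive.
Import Order.TTheory GRing.Theory Num.Theory.
Local Open Scope ring_scope.

(* Projective space. A point is represented by its unique homogeneous
   coordinate vector whose first nonzero entry is 1, so Leibniz equality is
   equality of points, and [ppoint k n] is a finType when k is finite. *)

Definition normalized (F : fieldType) (n : nat) (x : 'rV[F]_n.+1) : bool :=
  [exists i, (x 0 i == 1) && [forall j : 'I_n.+1, (j < i)%N ==> (x 0 j == 0)]].

Definition ppoint (F : fieldType) (n : nat) : Type :=
  {x : 'rV[F]_n.+1 | normalized x}.

Definition coords (F : fieldType) (n : nat) (x : ppoint F n) : 'I_n.+1 -> F :=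
  fun i => val x 0 i.

Definition homogeneous (F : fieldType) (n : nat) (p : {mpoly F[n]}) : Prop :=
  exists d : nat, {in msupp p, forall m : 'X_{1..n}, mdeg m = d}.

Definition zeros (F : fieldType) (n : nat) (s : seq {mpoly F[n.+1]})
    (x : ppoint F n) : bool :=
  all (fun p : {mpoly F[n.+1]} => p.@[coords x] == 0) s.

Section Zariski.
Variables (F : fieldType) (n : nat).
Implicit Types Z : ppoint F n -> Prop.

Definition subZ Z1 Z2 : Prop := forall x, Z1 x -> Z2 x.

Definition zclosed Z : Prop :=
  exists2 s : seq {mpoly F[n.+1]},
    {in s, forall p, homogeneous p} & forall x, Z x <-> zeros s x.

Definition zirreducible Z : Prop :=
  (exists x, Z x) /\
  forall Z1 Z2, zclosed Z1 -> zclosed Z2 ->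
    (forall x, Z x -> Z1 x \/ Z2 x) -> subZ Z Z1 \/ subZ Z Z2.

Definition has_chain Z (d : nat) : Prop :=
  exists C : nat -> ppoint F n -> Prop,
    (forall i, (i <= d)%N -> [/\ zclosed (C i), zirreducible (C i) & subZ (C i) Z])
    /\ (forall i, (i < d)%N -> subZ (C i) (C i.+1) /\ ~ subZ (C i.+1) (C i)).

(* Krull dimension; chains can be shortened, so d is the maximal length. *)
Definition has_dim Z (d : nat) : Prop := has_chain Z d /\ ~ has_chain Z d.+1.

End Zariski.

Section Varieties.
Variables (k : finFieldType) (K : closedFieldType) (iota : {rmorphism k -> K}).

(* The K-points of the projective algebraic set over k with equations s. *)
Definition gzeros (n : nat) (s : seq {mpoly k[n.+1]}) (x : ppoint K n) : bool :=
  zeros [seq map_mpoly iota p | p <- s] x.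

Definition gpoint (n : nat) (s : seq {mpoly k[n.+1]}) : Type :=
  {x : ppoint K n | gzeros s x}.

Definition gcoords (n : nat) (s : seq {mpoly k[n.+1]}) (x : gpoint s) :
    'I_n.+1 -> K :=
  coords (val x).

Definition bihomogeneous (n d e : nat) (p : {mpoly k[n.+1 + n.+1]}) : Prop :=
  {in msupp p, forall m : 'X_{1..n.+1 + n.+1},
     (\sum_(i < n.+1) m (lshift n.+1 i) = d)%N /\
     (\sum_(i < n.+1) m (rshift n.+1 i) = e)%N}.

Definition geval2 (n : nat) (p : {mpoly k[n.+1 + n.+1]}) (u v : 'I_n.+1 -> K) : K :=
  (map_mpoly iota p).@[fun i => match split i with inl j => u j | inr j => v j end].

(* Morphisms over k: around each point the map is given by forms over k of the
   same (bi)degree, not all zero at that point. Where these forms do not all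
   vanish they give homogeneous coordinates of the value; c = 0 is the case of
   simultaneous vanishing, since coordinate vectors are nonzero. Over a finite
   (hence perfect) field, reduced varieties and their products stay reduced
   over K, so such maps on K-points are exactly the k-morphisms. *)
Definition is_morphism (n : nat) (s : seq {mpoly k[n.+1]})
    (f : gpoint s -> gpoint s) : Prop :=
  forall x : gpoint s,
  exists (d : nat) (G : 'I_n.+1 -> {mpoly k[n.+1]}),
    [/\ forall i, {in msupp (G i), forall m : 'X_{1..n.+1}, mdeg m = d},
        exists i, (map_mpoly iota (G i)).@[gcoords x] != 0
      & forall x' : gpoint s, exists c : K, forall i,
          (map_mpoly iota (G i)).@[gcoords x'] = c * gcoords (f x') i].

Definition is_morphism2 (n : nat) (s : seq {mpoly k[n.+1]})
    (f : gpoint s -> gpoint s -> gpoint s) : Prop :=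
  forall x y : gpoint s,
  exists (d e : nat) (G : 'I_n.+1 -> {mpoly k[n.+1 + n.+1]}),
    [/\ forall i, bihomogeneous d e (G i),
        exists i, geval2 (G i) (gcoords x) (gcoords y) != 0
      & forall x' y' : gpoint s, exists c : K, forall i,
          geval2 (G i) (gcoords x') (gcoords y') = c * gcoords (f x' y') i].

(* Abelian varieties over k, as projective, geometrically irreducible group
   varieties over k; K is meant to be an algebraic closure of k. Smoothness
   and commutativity are consequences and are not part of the definition. *)
Record abvar : Type := AbVar {
  av_n : nat;
  av_eqs : seq {mpoly k[av_n.+1]};
  av_homog : {in av_eqs, forall p, homogeneous p};
  av_irr : zirreducible (fun x : ppoint K av_n => gzeros av_eqs x);
  av_zero : gpoint av_eqs;
  av_add : gpoint av_eqs -> gpoint av_eqs -> gpoint av_eqs;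
  av_opp : gpoint av_eqs -> gpoint av_eqs;
  av_zero_rat : exists u : ppoint k av_n,
    forall i, gcoords av_zero i = iota (coords u i);
  av_add_mor : is_morphism2 av_add;
  av_opp_mor : is_morphism av_opp;
  av_addA : associative av_add;
  av_add0 : left_id av_zero av_add;
  av_addr0 : right_id av_zero av_add;
  av_addN : left_inverse av_zero av_opp av_add;
  av_addrN : right_inverse av_zero av_opp av_add
}.

Definition av_point (A : abvar) : Type := gpoint (av_eqs A).

Definition av_dim (A : abvar) (g : nat) : Prop :=
  has_dim (fun x : ppoint K (av_n A) => gzeros (av_eqs A) x) g.

Definition av_rational (A : abvar) : {set ppoint k (av_n A)} :=
  [set x | zeros (av_eqs A) x].

Definition av_natmul (A : abvar) (N : nat) (x : av_point A) : av_point A :=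
  iter N (av_add x) (av_zero A).

Definition frobK (x : K) : K := x ^+ #|k|.

Lemma frobK_iota (a : k) : frobK (iota a) = iota a.
Proof. by rewrite /frobK -rmorphXn /= expf_card. Qed.

Lemma frobKD (x y : K) : frobK (x + y) = frobK x + frobK y.
Proof.
have [p p_pr pk] := finPcharP k.
have pK : p \in [pchar K] by rewrite (fmorph_pchar iota).
apply: exprDn_pchar; rewrite (eq_pnat _ (pcharf_eq pK)).
have := card_pprimeChar pk; rewrite /= => ->.
by rewrite pnatX pnat_id.
Qed.

Lemma frobK_meval (n : nat) (p : {mpoly k[n]}) (v : 'I_n -> K) :
  (map_mpoly iota p).@[fun i => frobK (v i)] = frobK (map_mpoly iota p).@[v].
Proof.
have k0 : (0 < #|k|)%N by apply/card_gt0P; exists 0.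
have f0 : frobK 0 = 0 by rewrite /frobK expr0n eqn0Ngt k0.
rewrite !mevalE (big_morph _ frobKD f0); apply: eq_bigr => m _.
rewrite mcoeff_map_mpoly /= {2}/frobK exprMn -/(frobK _) frobK_iota.
congr (_ * _); rewrite -prodrXl; apply: eq_bigr => i _.
by rewrite /frobK exprAC.
Qed.

Lemma frob_normalized (n : nat) (x : ppoint K n) :
  normalized (map_mx frobK (val x)).
Proof.
have k0 : (0 < #|k|)%N by apply/card_gt0P; exists 0.
have /existsP[i /andP[/eqP xi /forallP x0]] := valP x.
apply/existsP; exists i; rewrite mxE xi /frobK expr1n eqxx /=.
apply/forallP => j; apply/implyP => ji; rewrite mxE.
by have /implyP/(_ ji)/eqP -> := x0 j; rewrite /frobK expr0n eqn0Ngt k0.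
Qed.

Definition frob_ppoint (n : nat) (x : ppoint K n) : ppoint K n :=
  exist (fun y => is_true (normalized y)) _ (frob_normalized x).

Lemma frob_gzeros (n : nat) (s : seq {mpoly k[n.+1]}) (x : gpoint s) :
  gzeros s (frob_ppoint (val x)).
Proof.
have k0 : (0 < #|k|)%N by apply/card_gt0P; exists 0.
have /allP xs := valP x; apply/allP => p ps.
have /mapP[r rs def_p] := ps; have /eqP := xs _ ps; rewrite def_p => r0.
rewrite (@meval_eq _ _ _ (fun i => frobK (coords (val x) i))); last first.
  by move=> i; rewrite /coords /= mxE.
by rewrite frobK_meval r0 /frobK expr0n eqn0Ngt k0.
Qed.

(* The q-power Frobenius endomorphism, q = #|k|. *)
Definition frobenius (A : abvar) (x : av_point A) : av_point A :=
  exist (fun y => is_true (gzeros (av_eqs A) y)) _ (frob_gzeros x).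

(* [frob_charpoly A g l f]: f is the characteristic polynomial of the
   Frobenius endomorphism on the l-adic Tate module, a free Z_l-module of rank
   2g. As f has integer coefficients, it is determined by its reductions modulo
   the powers l^m, which are the characteristic polynomials of Frobenius on
   A[l^m] = T_l / l^m T_l, free of rank 2g over Z / l^m. *)
Definition frob_charpoly (A : abvar) (g l : nat) (f : {poly int}) : Prop :=
  forall m : nat,
  exists (phi : 'rV['Z_(l ^ m.+1)]_(2 * g) -> av_point A)
         (M : 'M['Z_(l ^ m.+1)]_(2 * g)),
    [/\ injective phi,
        {morph phi : u v / u + v >-> av_add u v},
        forall x, av_natmul (l ^ m.+1) x = av_zero A <-> exists u, phi u = x,
        forall u, frobenius (phi u) = phi (u *m M)
      & char_poly M = map_poly intr f].

End Varieties.

(* Formal power series, given by their coefficient sequences. *)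
Section FormalSeries.
Variable F : fieldType.
Implicit Types u v : nat -> F.

Definition fps_one : nat -> F := fun n => (n == 0)%:R.
Definition fps_mul u v : nat -> F := fun n => \sum_(i < n.+1) u i * v (n - i)%N.
Definition fps_exp u (j : nat) : nat -> F := iter j (fps_mul u) fps_one.

(* 1 / (1 - a t) *)
Definition fps_geom (a : F) : nat -> F := fun n => a ^+ n.

(* log u = \sum_(j >= 1) (-1)^(j-1) (u - 1)^j / j, for u with constant
   coefficient 1; the terms with j > n do not contribute to t^n. *)
Definition fps_log u : nat -> F := fun n =>
  \sum_(1 <= j < n.+1)
    (-1) ^+ j.-1 / j%:R * fps_exp (fun i => u i - fps_one i) j n.

Definition gen_binomial (r : F) (j : nat) : F :=
  (\prod_(i < j) (r - i%:R)) / j`!%:R.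

Definition harmonic_mean (g : nat) (y : 'I_g -> F) : F :=
  (g%:R^-1 * \sum_(i < g) (y i)^-1)^-1.

End FormalSeries.

(* t^{2g} f(1/t), for f of degree 2g *)
Definition recip_poly (g : nat) (f : {poly int}) : {poly int} :=
  \poly_(i < (2 * g).+1) f`_(2 * g - i)%N.

Definition zetaA (q g : nat) (f : {poly int}) : nat -> algC :=
  fps_mul (fun n => ((recip_poly g f)`_n)%:~R)
          (fps_mul (fps_geom 1) (fps_geom q%:R)).

(* log Z_A(t) = \sum_(n >= 1) N_n t^n / n *)
Definition Nnum (q g : nat) (f : {poly int}) (n : nat) : algC :=
  n%:R * fps_log (zetaA q g f) n.

(* Main.v *)
(* Write A_n for the coefficients of Z_A. From n A_n = sum_(1 <= j <= n) N_j A_(n-j)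
   and N_j >= N >= 0 one gets A_n >= 'C(N+n-1, n) by induction. The functional
   equation of f, paired with f'/f at 1, gives
     sum_(n <= g-2) A_n + sum_(n <= g-1) q^(g-1-n) A_n
       = (g f(1) - f'(1)) / (q - 1) = f(1) sum_i 1 / (q+1+x_i) = f(1) g / eta,
   and sum_(n <= r) 'C(N+n-1, n) = 'C(N+r, r) evaluates the first half of the
   lower bound. *)
Require Import Defs.
From mathcomp Require Import all_boot all_order all_algebra all_field.
From mathcomp Require Import mpoly.
From mathcomp Require Import ring zify.
Import Order.TTheory GRing.Theory Num.Theory.
Local Open Scope ring_scope.

(** * Logarithms of formal power series *)

Lemma fps_exp_coef (F : fieldType) (u : nat -> F) (p : {poly F}) (n : nat) :
  (forall i, (i <= n)%N -> u i = p`_i) ->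
  forall j i, (i <= n)%N -> fps_exp u j i = (p ^+ j)`_i.
Proof.
move=> up; elim=> [|j IH] i lei; first by rewrite expr0 coef1.
rewrite exprS coefM /fps_exp iterS /fps_mul.
apply: eq_bigr => h _; rewrite -/(fps_exp u j).
have leh : (h <= i)%N by rewrite -ltnS.
by rewrite up ?IH // (leq_trans _ lei) // leq_subr.
Qed.

Lemma coef_exp_lt (F : fieldType) (p : {poly F}) (i j : nat) :
  p`_0 = 0 -> (i < j)%N -> (p ^+ j)`_i = 0.
Proof.
move=> p0 ltij; have [r ->] : exists r, p = r * 'X.
  exists (\poly_(h < size p) p`_h.+1); apply/polyP => -[|h].
    by rewrite coefMX.
  rewrite coefMX /= coef_poly; case: ltnP => // les.
  by rewrite nth_default // (leq_trans les).
by rewrite exprMn_comm; [rewrite coefMXn ltij | apply: commr_polyX].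
Qed.

(* t u' = u * t (log u)', computed on polynomials truncated beyond degree n. *)
Lemma fps_log_rec (F : numFieldType) (u : nat -> F) (n : nat) : u 0 = 1 ->
  n%:R * u n = \sum_(i < n) i.+1%:R * fps_log u i.+1 * u (n - i.+1)%N.
Proof.
move=> u0; case: n => [|n]; first by rewrite big_ord0 mul0r.
pose U := \poly_(i < n.+2) u i; pose W := U - 1.
have U_ i : (i <= n.+1)%N -> U`_i = u i by move=> lei; rewrite coef_poly ltnS lei.
have W0 : W`_0 = 0 by rewrite coefB U_ // coef1 u0 subrr.
pose L := \sum_(1 <= j < n.+2) ((-1) ^+ j.-1 / j%:R) *: W ^+ j.
have L_ i : (i <= n.+1)%N -> fps_log u i = L`_i.
  move=> lei; rewrite /L coef_sum (big_cat_nat _ (n := i.+1)) //=.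
  rewrite [X in _ + X]big_nat_cond [X in _ + X]big1 ?addr0 => [|j]; last first.
    by rewrite andbT => /andP[ltij _]; rewrite coefZ coef_exp_lt ?mulr0.
  rewrite /fps_log; apply: eq_bigr => j _; rewrite coefZ; congr (_ * _).
  apply: (@fps_exp_coef F _ W n.+1) => // h leh.
  by rewrite coefB U_ // coef1.
(* [L^]()[is]W^[()] times a finite geometric sum in [- W], and [U] is 1 - (-W), so the product
   telescopes. The error term carries W^(n+1), which starts in degree n+1 and is invisible at
   coefficient n. *)
have dL : U * L^`() = U^`() * (1 - (- W) ^+ n.+1).
  have dW : U^`() = W^`() by rewrite derivB derivC subr0.
  have -> : L^`() = W^`() * \sum_(j < n.+1) (- W) ^+ j.
    rewrite /L big_add1 big_mkord raddf_sum mulr_sumr.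
    apply: eq_bigr => j _ /=; rewrite derivZ deriv_exp /= -scaler_nat scalerA.
    rewrite -mulrA mulVf ?pnatr_eq0 // mulr1.
    by rewrite scalerAr -[- W]scaleN1r exprZn.
  rewrite dW mulrCA; congr (_ * _); rewrite -[1 in RHS](expr1n _ n.+1) subrXX.
  rewrite opprK addrC /W subrK; congr (_ * _).
  by apply: eq_bigr => j _; rewrite expr1n mul1r.
have /= := congr1 (fun p : {poly F} => p`_n) dL.
rewrite coefMr mulrBr mulr1 coefB coef_deriv U_ // [X in _ - X]coefM.
rewrite [X in _ - X]big1 ?subr0 => [dL_n|j _]; last first.
  rewrite (@coef_exp_lt _ (- W)) ?mulr0 ?coefN ?W0 ?oppr0 //.
  by rewrite ltnS leq_subr.
rewrite mulr_natl -dL_n; apply: eq_bigr => j _.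
have ltj := ltn_ord j.
rewrite coef_deriv -L_ // U_ ?subSS; last by rewrite (leq_trans (leq_subr _ _)).
by rewrite [RHS]mulrC mulr_natl.
Qed.

(** * Rising factorials and the binomial lower bound *)

(** The coefficient of t^n in (1 - t)^(-a). Unlike in 'C(a+n-1, n), the parameter stays fixed as n
    grows, which suits recursions in n. *)
Definition rising {F : fieldType} (a : F) (n : nat) : F :=
  (\prod_(i < n) (a + i%:R)) / n`!%:R.

Lemma gen_binomial_rising (F : fieldType) (a r : F) (n : nat) :
  r = a + n%:R - 1 -> gen_binomial r n = rising a n.
Proof.
move=> ->; rewrite /gen_binomial /rising; congr (_ / _).
rewrite (reindex_inj rev_ord_inj); apply: eq_bigr => i _ /=.
by rewrite natrB // -natr1; ring.
Qed.

Lemma rising_rec (F : numFieldType) (a : F) (n : nat) :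
  n.+1%:R * rising a n.+1 = (a + n%:R) * rising a n.
Proof.
rewrite /rising big_ord_recr factS natrM /=.
have nz : n.+1%:R != 0 :> F by rewrite pnatr_eq0.
have fz : n`!%:R != 0 :> F by rewrite pnatr_eq0 -lt0n fact_gt0.
by field; rewrite fz nat1r nz.
Qed.

(** The hockey-stick identity: multiplying (1 - t)^(-a) by 1/(1 - t) takes partial sums of
    coefficients. *)
Lemma sum_rising (F : numFieldType) (a : F) (n : nat) :
  \sum_(i < n.+1) rising a i = rising (a + 1) n.
Proof.
elim: n => [|n IH]; first by rewrite big_ord1 /rising !big_ord0.
have nz : n.+1%:R != 0 :> F by rewrite pnatr_eq0.
rewrite big_ord_recr /= IH; apply: (mulfI nz); rewrite mulrDr !rising_rec.
(* Both sides are a(a+1)...(a+n) / n!. *)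
have -> : (a + n%:R) * rising a n = a * rising (a + 1) n.
  elim: n {IH nz} => [|n IH]; first by rewrite /rising !big_ord0 addr0.
  have nz : n.+1%:R != 0 :> F by rewrite pnatr_eq0.
  apply: (mulfI nz); rewrite mulrCA rising_rec IH [RHS]mulrCA rising_rec.
  by rewrite -natr1; ring.
by rewrite -natr1; ring.
Qed.

Lemma rising_ge0 (F : numFieldType) (a : F) (n : nat) : 0 <= a -> 0 <= rising a n.
Proof.
by move=> a0; rewrite mulr_ge0 ?invr_ge0 ?ler0n ?prodr_ge0 // => i _; rewrite addr_ge0.
Qed.

(** The recursion of [fps_log_rec] in the extremal case where every N_j equals a, since -a log(1 -
    t) is the sum of the a t^j / j. *)
Lemma rising_sum_rec (F : numFieldType) (a : F) (n : nat) :
  n%:R * rising a n = \sum_(i < n) a * rising a (n - i.+1).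
Proof.
rewrite (reindex_inj rev_ord_inj) -mulr_sumr /=.
under eq_bigr => i _ do rewrite subnSK // subKn 1?ltnW //.
elim: n => [|n IH]; first by rewrite big_ord0 mul0r mulr0.
by rewrite rising_rec big_ord_recr /= mulrDr -IH -mulrDl addrC.
Qed.

(** Strong induction: the two recursions compare term by term, and within each term factor by
    factor, as [N] and the rising factorials are nonnegative. *)
Lemma rising_le (F : numFieldType) (N : F) (u s : nat -> F) (m : nat) :
  u 0 = 1 -> 0 <= N -> (forall i, (i < m)%N -> N <= s i.+1) ->
  (forall n, n%:R * u n = \sum_(i < n) s i.+1 * u (n - i.+1)%N) ->
  forall n, (n <= m)%N -> rising N n <= u n.
Proof.
move=> u0 N0 Ns u_rec n; have [h] := ubnP n; elim: h n => // h IH [|n] lth lem.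
  by rewrite u0 /rising big_ord0 fact0 divr1.
have n0 : 0 < n.+1%:R :> F by rewrite ltr0n.
rewrite -(ler_pM2l n0) rising_sum_rec u_rec; apply: ler_sum => i _.
have lti := ltn_ord i.
apply: ler_pM; rewrite ?rising_ge0 // ?Ns ?(leq_trans lti) //.
by apply: IH; lia.
Qed.

(** * Weighted partial sums of Cauchy products *)

(** Both sides are the coefficient of t^(g-1) in p c / (1 - a t); the factor 1/(1 - a t) is absorbed
    into c. Taking a = 1 gives plain partial sums. *)
Lemma sum_powers_conv (F : fieldType) (a : F) (p c : nat -> F) (g : nat) :
  \sum_(n < g) a ^+ (g - n.+1) * fps_mul p c n =
  \sum_(i < g) p i * \sum_(m < g - i) a ^+ (g - i - m.+1) * c m.
Proof.
pose S r := \sum_(m < r) a ^+ (r - m.+1) * c m.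
have S_rec (d : nat -> F) r : \sum_(m < r.+1) a ^+ (r.+1 - m.+1) * d m =
    a * (\sum_(m < r) a ^+ (r - m.+1) * d m) + d r.
  rewrite big_ord_recr /= subnn mul1r mulr_sumr; congr (_ + _).
  apply: eq_bigr => i _; rewrite mulrA -exprS; congr (_ ^+ _ * _).
  by have := ltn_ord i; lia.
elim: g => [|g IH]; first by rewrite !big_ord0.
rewrite S_rec IH /fps_mul.
have -> : \sum_(i < g) p i * S (g - i)%N = \sum_(i < g.+1) p i * S (g - i)%N.
  by rewrite big_ord_recr /= subnn /S big_ord0 mulr0 addr0.
rewrite mulr_sumr -big_split /=; apply: eq_bigr => i _.
by rewrite subSn ?S_rec ?mulrDr 1?mulrCA // -ltnS.
Qed.

Lemma geom_conv (F : fieldType) (q : F) (m : nat) :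
  (q - 1) * fps_mul (fps_geom 1) (fps_geom q) m = q ^+ m.+1 - 1.
Proof.
rewrite -[1 in RHS](expr1n _ m.+1) subrXX; congr (_ * _).
by apply: eq_bigr => i _; rewrite /fps_geom mulrC.
Qed.

(** Each sum alone has a closed form with denominator (q-1)^2. In the total the bare q^(r+1) terms
    cancel and a factor q-1 splits off. *)
Lemma sum_geom_conv (F : fieldType) (q : F) (r : nat) :
  let c := fps_mul (fps_geom 1) (fps_geom q) in q != 1 ->
  (q - 1) * (\sum_(m < r) c m + \sum_(m < r.+1) q ^+ (r - m) * c m) =
  r.+1%:R * (q ^+ r.+1 - 1).
Proof.
move=> c q1; have nz : q - 1 != 0 by rewrite subr_eq0.
have c_ m : (q - 1) * c m = q ^+ m.+1 - 1 by apply: geom_conv.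
have s1 n : (q - 1) * ((q - 1) * \sum_(m < n) c m) = q ^+ n.+1 - q - n%:R * (q - 1).
  elim: n => [|n IH]; first by rewrite big_ord0; ring.
  by rewrite big_ord_recr /= 2!mulrDr IH c_ -natr1 !exprS; ring.
have s2 n : (q - 1) * ((q - 1) * \sum_(m < n.+1) q ^+ (n - m) * c m) =
    n.+1%:R * (q - 1) * q ^+ n.+1 - (q ^+ n.+1 - 1).
  elim: n => [|n IH]; first by rewrite big_ord1 subnn mul1r c_; ring.
  have -> : \sum_(m < n.+2) q ^+ (n.+1 - m) * c m =
      q * (\sum_(m < n.+1) q ^+ (n - m) * c m) + c n.+1.
    rewrite big_ord_recr /= subnn mul1r mulr_sumr; congr (_ + _).
    by apply: eq_bigr => i _; rewrite mulrA -exprS subSn // -ltnS.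
  rewrite 2!mulrDr c_ [(q - 1) * (q * _)]mulrCA [(q - 1) * (q * _)]mulrCA IH.
  by rewrite -[n.+2%:R]natr1 -natr1 !exprS; ring.
apply: (mulfI nz); rewrite 2!mulrDr s1 s2 -natr1 !exprS; ring.
Qed.

(** * Symmetry and derivative at 1 of Weil polynomials *)

Lemma deriv_prod_horner (F : fieldType) (g : nat) (Q : 'I_g -> {poly F}) (x : F) :
  (forall i, (Q i).[x] != 0) ->
  (\prod_i Q i)^`().[x] = (\prod_i Q i).[x] * \sum_i (Q i)^`().[x] / (Q i).[x].
Proof.
elim: g Q => [|g IH] Q nz; first by rewrite !big_ord0 derivC horner0 mulr0.
rewrite !big_ord_recl derivM hornerD !hornerM IH; last by move=> i; apply: nz.
by field; apply: nz.
Qed.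

(* f(q x) = q^g x^(2g) f(1/x), compared at enough nonzero points x. *)
Lemma coef_weil_sym (F : numFieldType) (q : F) (g : nat) (y : 'I_g -> F)
    (f : {poly F}) :
  f = \prod_(i < g) ('X ^+ 2 + y i *: 'X + q%:P) ->
  (size f <= (2 * g).+1)%N ->
  forall i, (i <= 2 * g)%N -> q ^+ i * f`_i = q ^+ g * f`_(2 * g - i).
Proof.
move=> def_f size_f.
pose p := \poly_(i < (2 * g).+1) (q ^+ i * f`_i - q ^+ g * f`_(2 * g - i)).
suff p0 : p = 0.
  move=> i lei; have := congr1 (fun r : {poly F} => r`_i) p0.
  by rewrite coef_poly coef0 ltnS lei => /eqP; rewrite subr_eq0 => /eqP.
have p_root x : x != 0 -> p.[x] = 0.
  move=> x0; rewrite horner_poly.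
  under eq_bigr => i _ do rewrite mulrBl.
  rewrite sumrB.
  have -> : \sum_(i < (2 * g).+1) q ^+ i * f`_i * x ^+ i = f.[q * x].
    rewrite (horner_coef_wide _ size_f); apply: eq_bigr => i _.
    by rewrite exprMn mulrCA mulrA.
  have -> : \sum_(i < (2 * g).+1) q ^+ g * f`_(2 * g - i) * x ^+ i =
      q ^+ g * (x ^+ (2 * g) * f.[x^-1]).
    rewrite (horner_coef_wide _ size_f) (reindex_inj rev_ord_inj) !mulr_sumr /=.
    apply: eq_bigr => i _; rewrite subSS.
    have lei : (i <= 2 * g)%N by rewrite -ltnS.
    rewrite subKn // -mulrA; congr (_ * _); rewrite mulrCA; congr (_ * _).
    by rewrite exprVn -expfB_cond // (negPf x0).
  (* Factor by factor: (qx)^2 + y q x + q = q x^2 (x^(-2) + y x^(-1) + q). *)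
  apply/eqP; rewrite subr_eq0 def_f !horner_prod exprM.
  rewrite -[g in q ^+ g]card_ord -[g in (x ^+ 2) ^+ g]card_ord -!prodr_const -!big_split /=.
  apply/eqP; apply: eq_bigr => i _; rewrite !hornerE /=.
  by field.
(* The 2g+1 values 1, ..., 2g+1 are nonzero and distinct in characteristic 0, too many roots for
   degree at most 2g. *)
pose rs := [seq j.+1%:R : F | j <- iota 0 (2 * g).+1].
apply: (@roots_geq_poly_eq0 _ p rs).
- by apply/allP => _ /mapP[j _ ->]; apply/eqP/p_root; rewrite pnatr_eq0.
- rewrite map_inj_uniq ?iota_uniq // => j1 j2 /eqP.
  by rewrite eqr_nat => /eqP [].
- by rewrite size_map size_iota size_poly.
Qed.

(** The left side is the sum of the (g-i) f_i. The indices i and 2g-i have opposite weights, the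
    middle one has weight 0, and the symmetry expresses f_i through f_(2g-i). *)
Lemma sub_deriv1_sum (F : fieldType) (q : F) (g : nat) (f : {poly F}) :
  (size f <= (2 * g).+1)%N ->
  (forall i, (i < g)%N -> f`_i = q ^+ (g - i) * f`_(2 * g - i)) ->
  g%:R * f.[1] - f^`().[1] =
  \sum_(i < g) f`_(2 * g - i) * ((g - i)%:R * (q ^+ (g - i) - 1)).
Proof.
move=> size_f f_sym.
have -> : f^`().[1] = \sum_(i < (2 * g).+1) i%:R * f`_i.
  rewrite (@horner_coef_wide _ (2 * g)%N).
    rewrite big_ord_recl mul0r add0r; apply: eq_bigr => i _.
    by rewrite coef_deriv expr1n mulr1 mulr_natl.
  by rewrite (leq_trans (size_poly _ _)) // -subn1 leq_subLR add1n.
rewrite (horner_coef_wide _ size_f) mulr_sumr -sumrB.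
under eq_bigr => i _ do rewrite expr1n mulr1 -mulrBl.
rewrite -(big_mkord xpredT (fun i => (g%:R - i%:R) * f`_i)).
rewrite (big_cat_nat _ (n := g)) //=; last by lia.
rewrite big_mkord big_ltn; last by lia.
rewrite subrr mul0r add0r.
have -> : \sum_(g.+1 <= i < (2 * g).+1) (g%:R - i%:R) * f`_i =
    - \sum_(i < g) (g - i)%:R * f`_(2 * g - i).
  rewrite big_nat_rev -sumrN /= -{1}[g.+1]add0n big_addn big_mkord.
  have -> : ((2 * g).+1 - g.+1 = g)%N by lia.
  apply: eq_bigr => i _; have lti := ltn_ord i.
  have -> : (g.+1 + (2 * g).+1 - (i + g.+1).+1 = 2 * g - i)%N by lia.
  rewrite -mulNr; congr (_ * _); rewrite !natrB; try lia.
  by rewrite mulSn mul1n natrD; ring.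
rewrite -sumrN -big_split /=; apply: eq_bigr => i _.
rewrite f_sym // (natrB _ (ltnW (ltn_ord i))); ring.
Qed.

Lemma recip_poly_coef (g : nat) (f : {poly int}) (n : nat) : (n <= 2 * g)%N ->
  ((recip_poly g f)`_n)%:~R = (map_poly intr f)`_(2 * g - n) :> algC.
Proof. by move=> len; rewrite coef_poly ltnS len coef_map. Qed.

Lemma weil_quadratic (q : nat) (w : algC) : `|w| = sqrtC q%:R ->
  ('X - w%:P) * ('X - (w^*)%:P) = 'X ^+ 2 + - (w + w^*) *: 'X + q%:R%:P.
Proof.
move=> w_norm; have <- : w * w^* = q%:R by rewrite -normCK w_norm sqrtCK.
by rewrite -mul_polyC polyCN polyCD polyCM; ring.
Qed.

(** The number is |1 - w|^2, and w = 1 would force q = 1. *)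
Lemma weil_factor_gt0 (q : nat) (w : algC) : (1 < q)%N -> `|w| = sqrtC q%:R ->
  0 < q%:R + 1 - (w + w^*).
Proof.
move=> q1 w_norm; have -> : q%:R + 1 - (w + w^*) = `|1 - w| ^+ 2.
  rewrite normCK rmorphB rmorph1 -[q%:R]sqrtCK -w_norm normCK.
  by ring.
rewrite exprn_gt0 // normr_gt0 subr_eq0; apply/eqP => w1.
move: w_norm; rewrite -w1 normr1 => /(congr1 (fun z => z ^+ 2)) /eqP.
by rewrite sqrtCK expr1n (eqr_nat _ 1) => /eqP qE; rewrite -qE in q1.
Qed.

(** * Coefficients of the zeta function in terms of the Weil polynomial *)

Section WeilPolynomial.
Variables (q g : nat) (f : {poly int}) (omega : 'I_g -> algC).
Hypothesis q_gt1 : (1 < q)%N.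
Hypothesis f_roots : map_poly intr f
  = \prod_(i < g) (('X - (omega i)%:P) * ('X - ((omega i)^*)%:P)) :> {poly algC}.
Hypothesis omega_norm : forall i, `|omega i| = sqrtC q%:R.

Let F : {poly algC} := map_poly intr f.
Let y i : algC := q%:R + 1 - (omega i + (omega i)^*).

Let F_quad : F = \prod_(i < g)
  ('X ^+ 2 + - (omega i + (omega i)^*) *: 'X + (q%:R)%:P).
Proof. by rewrite /F f_roots; apply: eq_bigr => i _; apply: weil_quadratic. Qed.

Let size_F : (size F <= (2 * g).+1)%N.
Proof.
rewrite /F f_roots (leq_trans (size_poly_prod_leq _ _)) // card_ord.
(* Each factor has size 3, and the bound for products gives 3g + 1 - g = 2g + 1. *)
rewrite (_ : \sum_i _ = 3 * g)%N; first by lia.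
rewrite -[g in RHS]card_ord mulnC -sum_nat_const; apply: eq_bigr => i _.
by rewrite size_Mmonic ?polyXsubC_eq0 ?monicXsubC // !size_XsubC.
Qed.

Let q_neq0 : q%:R != 0 :> algC.
Proof. by rewrite pnatr_eq0; lia. Qed.

Let F_sym i : (i <= g)%N -> F`_i = q%:R ^+ (g - i) * F`_(2 * g - i).
Proof.
move=> lei; have qi0 : q%:R ^+ i != 0 :> algC by rewrite expf_neq0.
apply: (mulfI qi0); rewrite (coef_weil_sym _ _ _ _ _ F_quad size_F); last by lia.
by rewrite mulrA -exprD subnKC.
Qed.

(** The symmetry at index 0 gives F_0 = q^g F_(2g), while F_0 is a product of g constant terms q. *)
Let F_lead : F`_(2 * g) = 1.
Proof.
have qg0 : q%:R ^+ g != 0 :> algC by rewrite expf_neq0.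
apply: (mulfI qg0); rewrite mulr1; have := F_sym 0 (leq0n g).
rewrite !subn0 => <-; rewrite -horner_coef0 F_quad horner_prod -[g in RHS]card_ord -prodr_const.
by apply: eq_bigr => i _; rewrite !hornerE /=; ring.
Qed.

Lemma zetaA0 : zetaA q g f 0 = 1.
Proof.
rewrite /zetaA /fps_mul !big_ord1 recip_poly_coef // !subn0 -/F F_lead.
by rewrite /fps_geom !expr0 !mulr1.
Qed.

(** Each quadratic factor Q has Q(1) = y and Q(1) - Q'(1) = q - 1, so it contributes 1 - Q'(1)/Q(1)
    = (q-1)/y. *)
Lemma weil_log_deriv :
  g%:R * F.[1] - F^`().[1] = (q%:R - 1) * (F.[1] * \sum_i (y i)^-1).
Proof.
have Q1 i : ('X ^+ 2 + - (omega i + (omega i)^*) *: 'X + (q%:R)%:P).[1] = y i.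
  by rewrite !hornerE /= /y; ring.
have y0 i : y i != 0 by rewrite gt_eqF ?weil_factor_gt0.
rewrite F_quad deriv_prod_horner => [|i]; last by rewrite Q1.
rewrite -F_quad [g%:R * _]mulrC -mulrBr mulrCA; congr (_ * _).
rewrite -[g in g%:R]card_ord -sumr_const -sumrB mulr_sumr.
apply: eq_bigr => i _; rewrite Q1; apply: (mulIf (y0 i)).
rewrite mulrBl mul1r !mulfVK //.
by rewrite !derivE !hornerE /= /y; ring.
Qed.

(** Pulling the numerator coefficients out of both sums leaves [sum_geom_conv] at r = g-i-1, whose
    value (g-i)(q^(g-i) - 1) is the weight in [sub_deriv1_sum]. *)
Lemma sum_zetaA : (0 < g)%N ->
  \sum_(n < g.-1) zetaA q g f n
    + \sum_(n < g) q%:R ^+ (g - 1 - n) * zetaA q g f n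
  = F.[1] * \sum_i (y i)^-1.
Proof.
move=> g0; have q1 : q%:R != 1 :> algC by rewrite (eqr_nat _ _ 1); lia.
have nz : q%:R - 1 != 0 :> algC by rewrite subr_eq0.
apply: (mulfI nz); rewrite -weil_log_deriv.
rewrite (sub_deriv1_sum _ _ _ _ size_F (fun i lti => F_sym i (ltnW lti))).
pose c := fps_mul (fps_geom 1) (fps_geom q%:R) : nat -> algC.
pose p n : algC := ((recip_poly g f)`_n)%:~R.
have -> : \sum_(n < g.-1) zetaA q g f n =
    \sum_(i < g) p i * \sum_(m < g - i.+1) c m.
  transitivity (\sum_(n < g.-1) 1 ^+ (g.-1 - n.+1) * fps_mul p c n).
    by apply: eq_bigr => i _; rewrite expr1n mul1r.
  (* The term i = g-1 has an empty inner sum, so both halves can range over i < g. *)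
  rewrite sum_powers_conv -[in RHS](prednK g0) big_ord_recr /= subnn.
  rewrite big_ord0 mulr0 addr0.
  apply: eq_bigr => i _; rewrite subSS; congr (_ * _).
  by apply: eq_bigr => m _; rewrite expr1n mul1r.
have -> : \sum_(n < g) q%:R ^+ (g - 1 - n) * zetaA q g f n =
    \sum_(i < g) p i * \sum_(m < (g - i.+1).+1) q%:R ^+ (g - i.+1 - m) * c m.
  transitivity (\sum_(n < g) q%:R ^+ (g - n.+1) * fps_mul p c n).
    by apply: eq_bigr => i _; rewrite -subnDA add1n.
  by rewrite sum_powers_conv; apply: eq_bigr => i _; rewrite -subnSK.
rewrite -big_split mulr_sumr; apply: eq_bigr => i _ /=.
have lti := ltn_ord i.
rewrite -mulrDr mulrCA sum_geom_conv // subnSK // /p recip_poly_coef //.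
by lia.
Qed.

End WeilPolynomial.

(** * The lower bound for the number of rational points *)

Theorem theorem3p14
  (k : finFieldType) (K : closedFieldType) (iota : {rmorphism k -> K})
  (algK : integralRange iota)
  (A : abvar iota) (g : nat) (g_ge2 : (2 <= g)%N) (dimA : av_dim A g)
  (l : nat) (l_prime : prime l) (l_char : l \notin [pchar k])
  (f : {poly int}) (fA : frob_charpoly A g l f)
  (omega : 'I_g -> algC)
  (f_roots : map_poly intr f
     = \prod_(i < g) (('X - (omega i)%:P) * ('X - ((omega i)^*)%:P)) :> {poly algC})
  (omega_norm : forall i, `|omega i| = sqrtC #|k|%:R)
  (card_A : (#|av_rational A|)%:Z = f.[1]) :
  let q : algC := #|k|%:R in
  let x (i : 'I_g) : algC := - (omega i + (omega i)^*) in
  let N_ (n : nat) : algC := Nnum #|k| g f n in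
  let N : algC := N_ 1%N in
  let eta : algC := harmonic_mean (fun i => q + 1 + x i) in
  (forall n : nat, (1 <= n <= 2 * g)%N -> 0 <= N <= N_ n) ->
  eta / g%:R *
    (gen_binomial (N + g%:R - 2%:R) (g - 2)
     + \sum_(n < g) q ^+ (g - 1 - n) * gen_binomial (N + n%:R - 1) n)
  <= (#|av_rational A|)%:R.
Proof.
move=> q x N_ N eta N_min.
have k_gt1 : (1 < #|k|)%N by apply: finNzRing_gt1.
have g0 : (0 < g)%N by apply: ltnW.
have N0 : 0 <= N by case/andP: (N_min 1 ltac:(lia)).
have u0 := zetaA0 _ _ _ _ k_gt1 f_roots omega_norm.
pose u := zetaA #|k| g f.
have le_u n : (n < g)%N -> rising N n <= u n.
  move=> ltn; apply: (rising_le _ N u N_ (2 * g)) => //; last by lia.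
    by move=> i lti; case/andP: (N_min i.+1 lti).
  by move=> m; apply: fps_log_rec.
pose S : algC := \sum_i (q + 1 + x i)^-1.
have y_gt0 i : 0 < q + 1 + x i by apply: weil_factor_gt0.
have S_gt0 : 0 < S.
  rewrite /S (bigD1 (Ordinal g0)) //= ltr_pwDl ?invr_gt0 //.
  by apply: sumr_ge0 => i _; rewrite invr_ge0 ltW.
have -> : eta / g%:R = S^-1.
  rewrite /eta /harmonic_mean -/S invfM invrK mulrAC divff ?mul1r //.
  by rewrite pnatr_eq0 -lt0n.
(* Since eta / g = 1/S, this form lets S^-1 cancel and leaves the value computed in [sum_zetaA]. *)
have -> : #|av_rational A|%:R = S^-1 * ((map_poly intr f).[1] * S).
  rewrite mulrCA mulVf ?gt_eqF // mulr1 -[1](rmorph1 intr) horner_map.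
  by rewrite -card_A.
rewrite ler_pM2l ?invr_gt0 // -(sum_zetaA _ _ _ _ k_gt1 f_roots omega_norm) //.
(* N + g - 2 = (N+1) + (g-2) - 1, so [sum_rising] unfolds this binomial into the g-1 bounds needed
   for the first sum. *)
rewrite (gen_binomial_rising _ (N + 1)); last first.
  by rewrite natrB //; ring.
rewrite -sum_rising (_ : (g - 2).+1 = g.-1); last by lia.
apply: lerD; apply: ler_sum => i _; have lti := ltn_ord i.
  by apply: le_u; lia.
rewrite (gen_binomial_rising _ N) // ler_wpM2l ?exprn_ge0 ?ler0n //.
exact: le_u.
Qed.
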